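(* Let $C^{\geq}(x;1,q;1)=\sum_{n\ge1}x^n\sum_{w}q^{\mathrm{area}(w)}$, the inner sum over all Catalan words $w$ of length $n$ avoiding the pattern $(\geq,\geq)$. Let $B(x,q)=\sum_{w\in\mathcal{B},\,w\ne\epsilon}x^{|w|}q^{\mathrm{area}(w)}$, where $\mathcal{B}$ is the set of Catalan words avoiding $(\geq,\geq)$ that do not end with two letters $ab$ with $a\ge b$. Then \[ C^{\geq}(x;1,q;1)= \sum_{i=1}^{\infty} x^i q^{\frac{i(i+1)}{2}} \prod_{j=0}^{i-1} \left(1+B\!\left(x q^j, q \right)\right). \]
   Context: A Catalan word of length $n\ge 0$ is a sequence $w=w_1\cdots w_n$ of non-negative integers with $w_1=0$ and $0\le w_i\le w_{i-1}+1$ for $i=2,\dots,n$; $|w|$ is its length and $\epsilon$ the empty word. It avoids the pattern $(\geq,\geq)$ if there is no index $i$ with $w_i\ge w_{i+1}\ge w_{i+2}$. $\mathrm{area}(w)=\sum_{i=1}^n(w_i+1)$. *)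

(* Defs.v *)
From HB Require Import structures.
From mathcomp Require Import all_boot all_order all_algebra.
From mathcomp Require Import boolp.
Set Implicit Arguments.
Unset Strict Implicit.
Unset Printing Implicit Defensive.

Import GRing.Theory.

(* Words are sequences of natural numbers; letters are indexed from 0, so
   w_i of the literature is nth 0 w i.-1.  The first letter, if any, is 0. *)
Definition catalan (w : seq nat) : bool :=
  (head 0 w == 0) && sorted (fun a b => b <= a.+1) w.

(* For i : 'I_(size w).-2, the three positions i, i + 1, i + 2 lie in w. *)
Definition avoids_geq_geq (w : seq nat) : bool :=
  ~~ [exists i : 'I_(size w).-2,
        (nth 0 w i >= nth 0 w i.+1) && (nth 0 w i.+1 >= nth 0 w i.+2)].

Definition ends_geq (w : seq nat) : bool :=
  (2 <= size w) && (nth 0 w (size w).-2 >= nth 0 w (size w).-1).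

Definition area (w : seq nat) : nat := \sum_(a <- w) a.+1.

Definition classC (w : seq nat) : bool := catalan w && avoids_geq_geq w.
Definition classB (w : seq nat) : bool := classC w && ~~ ends_geq w.

(* The letters of a Catalan word are smaller than its length, so the words of
   length n can be enumerated as n-tuples over 'I_n. *)
Lemma catalan_ltn_size w : catalan w -> all (fun a => a < size w) w.
Proof.
case/andP=> /eqP w0 /(sortedP 0) hw.
have le_nth i : i < size w -> nth 0 w i <= i.
  elim: i => [|i IHi] hi; first by rewrite nth0 w0.
  have /= hwi := hw i hi.
  by rewrite (leq_trans hwi) // ltnS IHi // ltnW.
by apply/(all_nthP 0) => i hi; exact: leq_ltn_trans (le_nth i hi) hi.
Qed.

Local Open Scope ring_scope.

(* Formal power series in one variable x. *)
Record fps (R : Type) := FPS { fps_coef :> nat -> R }.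

HB.instance Definition _ (R : Type) := gen_eqMixin (fps R).
HB.instance Definition _ (R : Type) := gen_choiceMixin (fps R).

Lemma fpsP (R : Type) (f g : fps R) : (forall n, f n = g n) -> f = g.
Proof. by case: f g => [f] [g] /= /funext ->. Qed.

Section FpsRing.
Variable R : comNzRingType.
Implicit Types f g h : fps R.

Definition fps_zero : fps R := FPS (fun=> 0).
Definition fps_opp f : fps R := FPS (fun n => - f n).
Definition fps_add f g : fps R := FPS (fun n => f n + g n).
Definition fps_one : fps R := FPS (fun n => (n == 0%N)%:R).
Definition fps_mul f g : fps R :=
  FPS (fun n => \sum_(i < n.+1) f i * g (n - i)%N).

Fact fps_addA : associative fps_add.
Proof. by move=> f g h; apply: fpsP => n /=; rewrite addrA. Qed.
Fact fps_addC : commutative fps_add.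
Proof. by move=> f g; apply: fpsP => n /=; rewrite addrC. Qed.
Fact fps_add0 : left_id fps_zero fps_add.
Proof. by move=> f; apply: fpsP => n /=; rewrite add0r. Qed.
Fact fps_addN : left_inverse fps_zero fps_opp fps_add.
Proof. by move=> f; apply: fpsP => n /=; rewrite addNr. Qed.

HB.instance Definition _ :=
  GRing.isZmodule.Build (fps R) fps_addA fps_addC fps_add0 fps_addN.

Definition fps_trunc n f : {poly R} := \poly_(i < n) f i.

Fact coef_fps_trunc n f i : (i < n)%N -> (fps_trunc n f)`_i = f i.
Proof. by move=> lt_in; rewrite coef_poly lt_in. Qed.

Fact coef_fps_mul_trunc N n f g : (n < N)%N ->
  fps_mul f g n = (fps_trunc N f * fps_trunc N g)`_n.
Proof.
move=> lt_nN; rewrite coefM; apply: eq_bigr => i _.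
rewrite !coef_fps_trunc //; first exact: leq_ltn_trans (leq_subr _ _) lt_nN.
exact: leq_trans (ltn_ord i) lt_nN.
Qed.

Fact fps_mulA : associative fps_mul.
Proof.
move=> f g h; apply: fpsP => n /=.
pose t := fps_trunc n.+1.
transitivity ((t f * (t g * t h))`_n).
  rewrite coefM; apply: eq_bigr => i _.
  rewrite coef_fps_trunc ?ltn_ord //; congr (_ * _).
  by apply: coef_fps_mul_trunc; rewrite ltnS leq_subr.
rewrite mulrA coefM; apply: eq_bigr => i _.
rewrite [(t h)`_ _]coef_fps_trunc ?ltnS ?leq_subr //; congr (_ * _).
by apply/esym/coef_fps_mul_trunc/ltn_ord.
Qed.

Fact fps_mulC : commutative fps_mul.
Proof.
by move=> f g; apply: fpsP => n; rewrite !(coef_fps_mul_trunc _ _ (ltnSn n)) mulrC.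
Qed.

Fact fps_mul1 : left_id fps_one fps_mul.
Proof.
move=> f; apply: fpsP => n /=.
by rewrite big_ord_recl big1 ?mul1r ?subn0 ?addr0 // => i _; rewrite mul0r.
Qed.

Fact fps_mulDl : left_distributive fps_mul +%R.
Proof.
move=> f g h; apply: fpsP => n /=; rewrite -big_split /=.
by apply: eq_bigr => i _; rewrite mulrDl.
Qed.

Fact fps_one_neq0 : fps_one != 0.
Proof.
apply/eqP => /(congr1 (fun f : fps R => f 0%N)) /= /eqP.
by rewrite oner_eq0.
Qed.

HB.instance Definition _ :=
  GRing.Zmodule_isComNzRing.Build (fps R)
    fps_mulA fps_mulC fps_mul1 fps_mulDl fps_one_neq0.

Definition fps_const (c : R) : fps R := FPS (fun n => if n == 0%N then c else 0).
Definition fps_X : fps R := FPS (fun n => (n == 1%N)%:R).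

(* The substitution f(x) |-> f(c x). *)
Definition fps_dilate (c : R) f : fps R := FPS (fun n => c ^+ n * f n).

(* Convergence in the x-adic topology: every coefficient is eventually
   constant, with the value prescribed by f. *)
Definition fps_cvg (u : nat -> fps R) f : Prop :=
  forall n, exists N, forall M, (N <= M)%N -> u M n = f n.

End FpsRing.

Arguments fps_X {R}.

(* Series in x whose coefficients are polynomials in q over the integers;
   the variable 'X of {poly int} plays the role of q. *)
Definition q : {poly int} := 'X.

Definition area_gf (P : pred (seq nat)) : fps {poly int} :=
  FPS (fun n => \sum_(w : n.-tuple 'I_n | P (map val w)) q ^+ area (map val w)).

Definition Cgf : fps {poly int} := area_gf (fun w => classC w && (w != [::])).
Definition Bgf : fps {poly int} := area_gf (fun w => classB w && (w != [::])).

(* Main.v *)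
Require Import Defs.
From mathcomp Require Import all_boot all_order all_algebra.
From mathcomp Require Import ring zify.
Set Implicit Arguments.
Unset Strict Implicit.

Import GRing.Theory.
Local Open Scope ring_scope.

(** Cut a nonempty Catalan word at its last zero: [w = u 0 (v + 1)], where [v]
    is again a Catalan word.  The word [w] avoids (>=,>=) iff [v] does and [u]
    avoids it without ending in a weak descent, since such a descent would be
    prolonged by the zero, while the zero is followed by an ascent.  Hence
    [C(x) = x q (1 + B(x)) (1 + C(q x))], and the claimed series is the
    iteration of this equation; the remainder after [N] steps is divisible
    by [x^N]. *)

(** * Coefficients of products and the substitution of c x for x *)

Section FpsDilate.
Context {R : comNzRingType}.
Implicit Types (f g : fps R) (c d : R).

Lemma fps_addE f g n : (f + g) n = f n + g n.
Proof. by []. Qed.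

Lemma fps_mulE f g n : (f * g) n = \sum_(i < n.+1) f i * g (n - i)%N.
Proof. by []. Qed.

Lemma fps_dilateE c f n : fps_dilate c f n = c ^+ n * f n.
Proof. by []. Qed.

Lemma fps_const_mulE c f n : (fps_const c * f) n = c * f n.
Proof.
rewrite fps_mulE big_ord_recl subn0 big1 ?addr0 // => i _.
by rewrite mul0r.
Qed.

Lemma fps_X_mulE f n : (fps_X * f) n.+1 = f n.
Proof.
rewrite fps_mulE !big_ord_recl mul0r add0r mul1r subSS subn0 big1 ?addr0 //.
by move=> i _; rewrite mul0r.
Qed.

Lemma fps_X_mulE0 f : (fps_X * f) 0%N = 0.
Proof. by rewrite fps_mulE big_ord1 mul0r. Qed.

Lemma fps_XnM_small f N n : (n < N)%N -> (fps_X ^+ N * f) n = 0.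
Proof.
elim: N n => // N IHN [|n] ltnN; rewrite exprS -mulrA ?fps_X_mulE0 //.
by rewrite fps_X_mulE IHN.
Qed.

Lemma fps_const1 : fps_const 1 = 1 :> fps R.
Proof. by apply: fpsP => -[]. Qed.

Lemma fps_constM c d : fps_const (c * d) = fps_const c * fps_const d.
Proof.
by apply: fpsP => n; rewrite fps_const_mulE /=; case: eqP; rewrite ?mulr0.
Qed.

Lemma fps_dilate1 c : fps_dilate c (1 : fps R) = 1.
Proof. by apply: fpsP => -[|n] /=; rewrite ?mulr1 ?mulr0. Qed.

Lemma fps_dilateD c f g :
  fps_dilate c (f + g) = fps_dilate c f + fps_dilate c g.
Proof. by apply: fpsP => n /=; rewrite mulrDr. Qed.

Lemma fps_dilateM c f g :
  fps_dilate c (f * g) = fps_dilate c f * fps_dilate c g.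
Proof.
apply: fpsP => n /=; rewrite big_distrr; apply: eq_bigr => i _ /=.
by rewrite mulrACA -exprD subnKC // -ltnS.
Qed.

Lemma fps_dilate_const c d : fps_dilate c (fps_const d) = fps_const d.
Proof. by apply: fpsP => -[|n] /=; rewrite ?mul1r ?mulr0. Qed.

Lemma fps_dilateX c : fps_dilate c fps_X = fps_const c * fps_X.
Proof.
by apply: fpsP => n; rewrite fps_const_mulE /=; case: n => [|[|n]]; rewrite ?mulr0.
Qed.

Lemma fps_dilate_dilate c d f :
  fps_dilate c (fps_dilate d f) = fps_dilate (c * d) f.
Proof. by apply: fpsP => n /=; rewrite exprMn mulrA. Qed.

Lemma fps_dilate_id f : fps_dilate 1 f = f.
Proof. by apply: fpsP => n /=; rewrite expr1n mul1r. Qed.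

End FpsDilate.

(** * Cutting words at their last zero *)

Definition glue (u v : seq nat) : seq nat := u ++ 0%N :: map succn v.

(** Index 0 tests the first three letters and index i + 1 tests the tail at i; this turns the
    bounded quantifier into a recursion on the word. *)
Lemma avoids_geq_geq_cons a b c s :
  avoids_geq_geq [:: a, b, c & s] =
  ~~ ((b <= a) && (c <= b))%N && avoids_geq_geq [:: b, c & s].
Proof.
rewrite /avoids_geq_geq -negb_or; congr (~~ _).
apply/existsP/orP => [[[[|i] lti] /= h]|[h|/existsP[[i lti] h]]].
- by left.
- by right; apply/existsP; exists (Ordinal (lti : (i < size s)%N)).
- by exists ord0.
- by exists (Ordinal (lti : (i.+1 < (size s).+1)%N)).
Qed.

Lemma avoids_geq_geq_short {s} : (size s <= 2)%N -> avoids_geq_geq s.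
Proof.
move=> hs; apply/existsPn => -[i lti]; exfalso.
by move: lti; case: s hs => [|a [|b [|]]].
Qed.

Lemma avoids_geq_geq_map_succ v : avoids_geq_geq (map succn v) = avoids_geq_geq v.
Proof.
elim: v => [|a [|b [|c v]] IHv] //; try by rewrite !avoids_geq_geq_short.
by rewrite /= !avoids_geq_geq_cons -/(map _ [:: b, c & v]) IHv.
Qed.

Lemma avoids_geq_geq_glue u v :
  avoids_geq_geq (glue u v) =
  [&& avoids_geq_geq u, ~~ ends_geq u & avoids_geq_geq v].
Proof.
(* The leading zero is followed by a positive letter, so no forbidden triple starts at it. *)
have glue0 : avoids_geq_geq (0%N :: map succn v) = avoids_geq_geq v.
  case: v => [|a [|b v]]; try by rewrite !avoids_geq_geq_short.
  by rewrite /= avoids_geq_geq_cons -/(map _ [:: a, b & v]) avoids_geq_geq_map_succ.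
elim: u => [|a [|b [|c u]] IHu]; rewrite /glue /=.
- by rewrite glue0 (@avoids_geq_geq_short [::]).
- rewrite (@avoids_geq_geq_short [:: a]) //= -glue0.
  (* The triple a, 0, b + 1 ends in an ascent. *)
  case: v {IHu glue0} => [|b v] /=; first by rewrite !avoids_geq_geq_short.
  by rewrite avoids_geq_geq_cons ltn0 andbF.
(* The triple a, b, 0 is forbidden exactly when b <= a, that is, when u ends in a weak descent. *)
- by rewrite avoids_geq_geq_cons -/(glue [:: b] v) IHu (@avoids_geq_geq_short [:: a; b]) //=
    (@avoids_geq_geq_short [:: b]) // leq0n andbT.
- by rewrite !avoids_geq_geq_cons -/(glue [:: b, c & u] v) IHu andbA.
Qed.

(** A zero may follow any letter, and the first letter of v, raised by 1, may follow that zero only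
    if it was 0: this is the head condition on v. *)
Lemma catalan_glue u v : catalan (glue u v) = catalan u && catalan v.
Proof.
have path_succ a s : path (fun a b => b <= a.+1)%N a.+1 (map succn s) =
    path (fun a b => b <= a.+1)%N a s.
  by elim: s a => //= b s IHs a; rewrite IHs.
have glue0 : path (fun a b => b <= a.+1)%N 0 (map succn v) = catalan v.
  by case: v => //= a v; rewrite path_succ /catalan /= ltnS leqn0.
by case: u => [|a u]; rewrite /glue /catalan /= ?cat_path /= glue0 ?andbA.
Qed.

Lemma classC_glue u v : classC (glue u v) = classB u && classC v.
Proof.
rewrite /classB /classC catalan_glue avoids_geq_geq_glue.
by case: (catalan u) (catalan v) (avoids_geq_geq u) (ends_geq u) => -[] [] [].
Qed.

(** Raising v costs one unit per letter, whence the substitution of q x for x; the inserted zero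
    costs 1, whence the factor q. *)
Lemma area_glue u v : area (glue u v) = (area v + size v + area u + 1)%N.
Proof.
have area_succ : area (map succn v) = (area v + size v)%N.
  elim: v => [|a v IHv]; first by rewrite /area !big_nil.
  by rewrite /area /= !big_cons -/(area _) -/(area v) IHv; lia.
by rewrite /area /glue big_cat big_cons /= -!/(area _) area_succ; lia.
Qed.

(** The letters after the inserted zero are positive, so it is the last zero and the length of v can
    be read off the word. *)
Lemma index_rev_glue u v : index 0%N (rev (glue u v)) = size v.
Proof.
rewrite /glue rev_cat rev_cons -cats1 -catA /= index_cat mem_rev.
rewrite ifF /= ?addn0 ?size_rev ?size_map //.
by apply/mapP => -[].
Qed.

Lemma glue_inj u u' v v' : size v = size v' ->
  glue u v = glue u' v' -> u = u' /\ v = v'.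
Proof.
move=> hv e.
have hu : size u = size u'.
  by have := congr1 size e; rewrite !size_cat /= !size_map hv => /addIn.
have /eqP := e; rewrite eqseq_cat // eqseq_cons /= => /andP[/eqP -> /eqP].
by move/(inj_map succn_inj) ->.
Qed.

Lemma glue_split w : 0%N \in w -> exists u v, w = glue u v.
Proof.
elim: w => // a w IHw; rewrite inE.
have [/IHw[u [v ->]] _|w0] := boolP (0%N \in w); first by exists (a :: u), v.
(* The head is the last zero here, so all later letters are positive and [succn] undoes [predn]. *)
rewrite orbF => /eqP <-; exists [::], (map predn w); congr (_ :: _).
rewrite -map_comp -[LHS]map_id; apply/eq_in_map => b wb /=.
by rewrite prednK // lt0n; apply: contraNneq w0 => <-.
Qed.

(** * Listing Catalan words by length *)

(** Plain sequences put words of different lengths, hence over different alphabets ['I_n], into one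
    type, as gluing requires. *)
Definition catalan_words n : seq (seq nat) :=
  [seq w <- [seq map val (tval t) | t : n.-tuple 'I_n] | catalan w].

Lemma catalan_words_uniq n : uniq (catalan_words n).
Proof.
rewrite filter_uniq // map_inj_uniq ?enum_uniq // => s t.
by move/(inj_map val_inj)/val_inj.
Qed.

Lemma mem_catalan_words n w :
  (w \in catalan_words n) = catalan w && (size w == n).
Proof.
rewrite mem_filter; case: (boolP (catalan w)) => //= cw.
apply/mapP/eqP => [[t _ ->]|sw]; first by rewrite size_map size_tuple.
case: n / sw.
have /allP lt_w := catalan_ltn_size cw.
have wE : map val (pmap insub w : seq 'I_(size w)) = w.
  rewrite pmap_filter; last exact: insubK.
  apply/all_filterP/allP => a wa; rewrite insubT //; exact: lt_w.
have sz : size (pmap insub w : seq 'I_(size w)) == size w.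
  by rewrite -[X in _ == X](congr1 size wE) size_map.
by exists (Tuple sz); rewrite ?mem_enum.
Qed.

Lemma mem_catalan_words_filter (P : pred (seq nat)) n w : subpred P catalan ->
  (w \in [seq w <- catalan_words n | P w]) = P w && (size w == n).
Proof.
move=> sPc; rewrite mem_filter mem_catalan_words andbA.
by case: (boolP (P w)) => // /sPc ->.
Qed.

Lemma area_gf_words (P : pred (seq nat)) n : subpred P catalan ->
  area_gf P n = \sum_(w <- catalan_words n | P w) q ^+ area w.
Proof.
move=> sPc; rewrite big_filter_cond big_map big_enum_cond /=.
by apply: eq_bigl => t; case: (boolP (P _)) => [/sPc ->|]; rewrite ?andbF.
Qed.

Lemma area_gf_nonempty (P : pred (seq nat)) : P [::] ->
  1 + area_gf (fun w => P w && (w != [::])) = area_gf P.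
Proof.
move=> P0; apply: fpsP => -[|n]; rewrite /= ?add0r.
  rewrite big1 ?addr0 => [|t]; last by rewrite tuple0 andbF.
  rewrite (big_pred1 [tuple]) => [|t]; first by rewrite /area big_nil.
  by rewrite [t]tuple0 P0; apply/esym/eqP/esym; exact: tuple0.
apply: eq_bigl => t; rewrite -size_eq0 size_map size_tuple andbT //.
Qed.

(** * The functional equation *)

Lemma classC_gf_rec n :
  area_gf classC n.+1 = q * (fps_dilate q (area_gf classC) * area_gf classB) n.
Proof.
have sCc : subpred classC catalan by move=> w /andP[].
have sBc : subpred classB catalan by move=> w /andP[/sCc].
(* The number of letters after the last zero; a Catalan word of length n + 1 contains a zero, so
   [inord] never falls back on its default. *)
pose p w : 'I_n.+1 := inord (index 0%N (rev w)).
rewrite area_gf_words // (partition_big p xpredT) // fps_mulE big_distrr.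
apply: eq_bigr => i _; rewrite fps_dilateE !area_gf_words //.
rewrite -mulrA big_distrlr /=.
(* Gluing is a bijection from pairs of lengths i and n - i onto the block of words with i letters
   after the last zero; summing over i gives the Cauchy product. *)
pose L := [seq glue u v | v <- [seq v <- catalan_words i | classC v],
                          u <- [seq u <- catalan_words (n - i) | classB u]].
rewrite -big_filter (perm_big L) /=; last first.
  apply: uniq_perm; first exact/filter_uniq/catalan_words_uniq.
    apply: allpairs_uniq; try exact/filter_uniq/catalan_words_uniq.
    move=> _ _ /allpairsP[[v u] /= [hv _ ->]] /allpairsP[[v' u'] /= [hv' _ ->]] /=.
    move: hv hv'; rewrite !mem_catalan_words_filter //.
    move=> /andP[_ /eqP sv] /andP[_ /eqP sv'] e.
    by have [|-> ->] := glue_inj _ e; rewrite ?sv ?sv'.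
  move=> w; rewrite mem_catalan_words_filter; last by move=> ? /andP[/sCc].
  apply/andP/allpairsP => [[/andP[Cw /eqP pw] /eqP sw]|].
    have /glue_split[u [v wE]] : 0%N \in w.
      move/sCc: Cw; case: w sw {pw} => //= a w _ /andP[/eqP /= -> _].
      by rewrite mem_head.
    move: Cw pw sw; rewrite wE classC_glue /p index_rev_glue /glue size_cat /= size_map.
    move=> /andP[Bu Cv] pv; rewrite addnS => -[suv].
    have sv : size v = i by rewrite -pv inordK // -suv ltnS leq_addl.
    have su : size u = (n - i)%N by rewrite -sv; lia.
    by exists (v, u); rewrite !mem_catalan_words_filter //= Bu Cv sv su !eqxx.
  move=> [[v u] /= []]; rewrite !mem_catalan_words_filter //.
  move=> /andP[Cv /eqP sv] /andP[Bu /eqP su] ->.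
  have Cg : classC (glue u v) by rewrite classC_glue Bu.
  rewrite Cg /p index_rev_glue sv inord_val size_cat /= size_map su sv.
  by rewrite addnS subnK ?eqxx // -ltnS.
rewrite big_allpairs_dep big_filter !big_distrr /=.
rewrite big_seq_cond [RHS]big_seq_cond.
apply: eq_bigr => v; rewrite mem_catalan_words => /andP[/andP[_ /eqP sv] _].
rewrite big_filter !big_distrr /=; apply: eq_bigr => u _.
rewrite area_glue sv !exprD expr1.
by rewrite [q ^+ area v * _]mulrC -!mulrA [q * _]mulrC -!mulrA.
Qed.

Lemma Cgf_functional :
  Cgf = fps_X * fps_const q * (1 + Bgf) * (1 + fps_dilate q Cgf).
Proof.
rewrite -[X in X + fps_dilate _ _](fps_dilate1 q) -fps_dilateD.
have nil_ok : classB [::].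
  by rewrite /classB /classC avoids_geq_geq_short.
have nilC : classC [::] by case/andP: nil_ok.
rewrite !area_gf_nonempty // -!mulrA; apply: fpsP => -[|n].
  (* At length 0 the factor x kills the right side, and [Cgf] excludes the empty word. *)
  by rewrite fps_X_mulE0 /= big1 // => t; rewrite tuple0 andbF.
rewrite fps_X_mulE fps_const_mulE [X in _ * fps_coef X _]mulrC -classC_gf_rec.
by rewrite -area_gf_nonempty //= add0r.
Qed.

(** * Iteration of the functional equation *)

Theorem theorem4p2 :
  fps_cvg
    (fun N : nat =>
       \sum_(1 <= i < N.+1)
          fps_X ^+ i * fps_const (q ^+ (i * (i + 1) %/ 2)%N)
          * \prod_(0 <= j < i) (1 + fps_dilate (q ^+ j) Bgf))
    Cgf.
Proof.
pose T i : fps {poly int} := fps_X ^+ i * fps_const (q ^+ (i * (i + 1) %/ 2)%N) *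
  \prod_(0 <= j < i) (1 + fps_dilate (q ^+ j) Bgf).
have remainder N :
    Cgf = \sum_(1 <= i < N.+1) T i +
      fps_X ^+ N * (fps_const (q ^+ (N * (N + 1) %/ 2)%N) *
        \prod_(0 <= j < N) (1 + fps_dilate (q ^+ j) Bgf) *
        fps_dilate (q ^+ N) Cgf).
  elim: N => [|N IHN].
    by rewrite !big_geq // add0r !expr0 fps_dilate_id fps_const1 !mul1r.
  rewrite {1}IHN [X in _ = X + _]big_nat_recr //= -addrA; congr (_ + _).
  (* The exponent of q grows by N from dilating x and by 1 from the factor q. *)
  have triS : (N.+1 * (N.+1 + 1) %/ 2 = N + (1 + N * (N + 1) %/ 2))%N.
    have -> : (N.+1 * (N.+1 + 1) = N.+1 * 2 + N * (N + 1))%N by ring.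
    by rewrite divnMDl // addnA addn1.
  rewrite /T triS !exprD expr1 !fps_constM big_nat_recr //=.
  (* Replacing x by q^N x in the equation gives the new factor 1 + B(q^N x); in 1 + C(q^(N+1) x),
     the 1 yields the next term and the rest the next remainder. *)
  rewrite [in LHS]Cgf_functional !fps_dilateM !fps_dilateD !fps_dilate1.
  rewrite fps_dilateX fps_dilate_const fps_dilate_dilate !exprSr.
  ring.
(* For M > n the remainder, a multiple of x^M, has no coefficient at n. *)
move=> n; exists n.+1 => M ltnM.
have /(congr1 (fun f : fps _ => f n)) := remainder M.
by rewrite fps_addE fps_XnM_small // addr0 => ->.
Qed.
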